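(* Let $\sigma = (\lambda_1,\lambda_2,\lambda_3,\lambda_4,\lambda_5)$ be a list of real numbers and let $g\in\mathbb{R}$ be such that (i) $e_1(\sigma)\ge 0$; (ii) $\lambda_3 > e_1(\sigma)$; (iii) $\lambda_1\ge\lambda_2\ge\lambda_3\ge\lambda_4\ge\lambda_5\ge-\lambda_1$; (iv) $g$ is a root of the polynomial $Q_\sigma(z)$ and $0\le g\le\frac12 e_1(\sigma)$; (v) $r(\sigma)<0$. Then $\sigma_i^{-s}$ is realizable by a $5\times5$ symmetric nonnegative matrix for any positive real number $s$ and any $i\in\{2,3,4,5\}$.
   Context: For a list $\sigma=(\lambda_1,\dots,\lambda_5)$, $e_n=e_n(\sigma)=\sum_{1\le j_1<\dots<j_n\le 5}\prod_{i=1}^n \lambda_{j_i}$ are the elementary symmetric functions (so $e_1(\sigma)=\sum_i\lambda_i$), $r(\sigma)=e_3(\sigma)+e_1(\sigma)(\lambda_2^2+\lambda_5^2)$, and $$Q_\sigma(z)=2z^3-2(\lambda_3+\lambda_5)z^2-\left(e_2+(\lambda_3-\lambda_5)^2\right)z+e_3+e_1(\lambda_3^2+\lambda_5^2).$$ For $s>0$ and $i\in\{2,\dots,5\}$, $\sigma_i^{-s}$ denotes the list $\sigma$ with $\lambda_1$ replaced by $\lambda_1+s$ and $\lambda_i$ replaced by $\lambda_i-s$. A matrix is nonnegative if all its entries are nonnegative real numbers. A list is realizable by a matrix if it is the spectrum of that matrix, eigenvalues being counted with multiplicity and the order of the list being irrelevant. *)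

(* Defs.v *)
From HB Require Import structures.
From mathcomp Require Import all_boot all_order all_algebra reals.

Set Implicit Arguments.
Unset Strict Implicit.
Unset Printing Implicit Defensive.

Import Order.TTheory GRing.Theory Num.Theory.
Local Open Scope ring_scope.

(* Entries of a list are numbered from 1: [lam s i] is the i-th entry,
   meaningful only for 1 <= i <= 5. *)
Definition lam (R : realType) (s : 5.-tuple R) (i : nat) : R := nth 0 s i.-1.

(* An increasing choice j_1 < ... < j_n of indices is a set of n indices. *)
Definition esf (R : realType) (s : 5.-tuple R) (n : nat) : R :=
  \sum_(J : {set 'I_5} | #|J| == n) \prod_(j in J) tnth s j.

Definition rfun (R : realType) (s : 5.-tuple R) : R :=
  esf s 3 + esf s 1 * (lam s 2 ^+ 2 + lam s 5 ^+ 2).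

Definition Qpoly (R : realType) (s : 5.-tuple R) : {poly R} :=
  2 *: 'X^3
  - (2 * (lam s 3 + lam s 5)) *: 'X^2
  - (esf s 2 + (lam s 3 - lam s 5) ^+ 2) *: 'X
  + (esf s 3 + esf s 1 * (lam s 3 ^+ 2 + lam s 5 ^+ 2))%:P.

(* Here i is a 1-based position, so 'I_5 index j is position j.+1. *)
Definition perturb (R : realType) (s : 5.-tuple R) (i : nat) (t : R) :
    5.-tuple R :=
  [tuple if (j : nat) == 0%N then tnth s j + t
         else if j.+1 == i then tnth s j - t
         else tnth s j | j < 5].

Definition has_spectrum (R : realType) (n : nat) (A : 'M[R]_n)
    (s : n.-tuple R) : Prop :=
  char_poly A = \prod_(x <- s) ('X - x%:P).

Definition nonneg_mx (R : realType) (n : nat) (A : 'M[R]_n) : Prop :=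
  forall i j : 'I_n, 0 <= A i j.

Definition sym_mx (R : realType) (n : nat) (A : 'M[R]_n) : Prop :=
  A^T = A.

Definition sym_nonneg_realizable (R : realType) (n : nat)
    (s : n.-tuple R) : Prop :=
  exists A : 'M[R]_n, [/\ sym_mx A, nonneg_mx A & has_spectrum A s].

(* Main.v *)
Require Import Defs.
From HB Require Import structures.
From mathcomp Require Import all_boot all_order all_algebra reals.
From mathcomp Require Import ring lra.

Set Implicit Arguments.
Unset Strict Implicit.
Unset Printing Implicit Defensive.

Import Order.TTheory GRing.Theory Num.Theory.
Local Open Scope ring_scope.

(* A symmetric matrix [[P, Q, u], [Q, P, u], [u^T, u^T, d]] with 2x2 blocks P, Q
   has the spectrum of N = P - Q together with that of the bordered matrix
   B = [[M, w], [w^T, d]], where M = P + Q and w = sqrt 2 u; it is nonnegative as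
   soon as |N| <= M entrywise and w, d >= 0.  Give N the eigenvalues
   lambda_3, lambda_5, the diagonal (g, lambda_3 + lambda_5 - g), M = |N| and
   d = e_1 - 2g.  A nonnegative w giving B the three remaining eigenvalues exists
   if these interlace the eigenvalues of M and Q(g) >= 0.  Both conditions
   hold for sigma at the root g and persist, with the same g, under each
   perturbation, because the increment of Q(g) is nonnegative.  Only when the
   perturbation pushes lambda_2 or lambda_3 below e_1 is another choice
   needed: N then takes the other of these two, together with lambda_4, and M is
   chosen with lambda_5 as an eigenvalue. *)

(** * Determinants and characteristic polynomials of block matrices *)

Section Poly.
Variable R : comNzRingType.

(** [L] subtracts the second block row from the first and [S] adds the first block column to the
    second; the upper right block then vanishes. *)
Lemma det_reflection (P Q : 'M[R]_2) (u : 'cV[R]_2) (v : 'rV[R]_2) (d : 'M[R]_1) :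
  \det (block_mx P (row_mx Q u) (col_mx Q v) (block_mx P u v d)) =
  \det (P - Q) * \det (block_mx (P + Q) u (v + v) d).
Proof.
pose L : 'M[R]_(2 + (2 + 1)) := block_mx 1%:M (row_mx (- 1%:M) 0) 0 1%:M.
pose S : 'M[R]_(2 + (2 + 1)) := block_mx 1%:M (row_mx 1%:M 0) 0 1%:M.
have detL : \det L = 1 by rewrite det_ublock !det1 mulr1.
have detS : \det S = 1 by rewrite det_ublock !det1 mulr1.
rewrite -[LHS]mul1r -[LHS]mulr1 -{1}detL -detS -!det_mulmx.
have -> : L *m block_mx P (row_mx Q u) (col_mx Q v) (block_mx P u v d) *m S =
    block_mx (P - Q) 0 (col_mx Q v) (block_mx (P + Q) u (v + v) d).
  rewrite !mulmx_block !mul1mx !mulmx1 !mul0mx !mulmx0 !addr0 !add0r.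
  rewrite mul_row_col mul_row_block mul_col_row !mulmx1 !mulmx0 !mul0mx !mulNmx.
  rewrite !mul1mx ?addr0 mul_mx_row mulmx1 mulmx0 add_block_mx add_row_mx add_row_mx.
  by rewrite !add0r !subrr addrA subrK subrr row_mx0 [Q + P]addrC.
by rewrite det_lblock.
Qed.

Lemma det_mx2 (A : 'M[R]_2) : \det A = A 0 0 * A 1 1 - A 0 1 * A 1 0.
Proof.
rewrite (expand_det_row _ 0) !big_ord_recl big_ord0 addr0 /cofactor !det_mx11 !mxE.
(* Reading entries through natural numbers identifies the various forms of one ordinal. *)
pose f (i j : nat) := A (inord i) (inord j).
have AE i j : A i j = f i j by rewrite /f !inord_val.
by rewrite !AE /= /bump /=; ring.
Qed.

Lemma det_mx3 (A : 'M[R]_3) : \det A =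
  A 0 0 * (A 1 1 * A ord_max ord_max - A 1 ord_max * A ord_max 1)
  - A 0 1 * (A 1 0 * A ord_max ord_max - A 1 ord_max * A ord_max 0)
  + A 0 ord_max * (A 1 0 * A ord_max 1 - A 1 1 * A ord_max 0).
Proof.
rewrite (expand_det_row _ 0) !big_ord_recl big_ord0 addr0 /cofactor !det_mx2 !mxE.
pose f (i j : nat) := A (inord i) (inord j).
have AE i j : A i j = f i j by rewrite /f !inord_val.
by rewrite !AE /= /bump /=; ring.
Qed.

Lemma det_bordered2 (M : 'M[R]_2) (u : 'cV[R]_2) (v : 'rV[R]_2) (d : 'M[R]_1) :
  \det (block_mx M u v d) =
  M 0 0 * (M 1 1 * d 0 0 - u 1 0 * v 0 1)
  - M 0 1 * (M 1 0 * d 0 0 - u 1 0 * v 0 0)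
  + u 0 0 * (M 1 0 * v 0 1 - M 1 1 * v 0 0).
Proof.
set B := block_mx M u v d.
have Eul i j : B (lshift 1 i) (lshift 1 j) = M i j by exact: block_mxEul.
have Eur i j : B (lshift 1 i) (rshift 2 j) = u i j by exact: block_mxEur.
have Edl i j : B (rshift 2 i) (lshift 1 j) = v i j by exact: block_mxEdl.
have Edr i j : B (rshift 2 i) (rshift 2 j) = d i j by exact: block_mxEdr.
rewrite -!Eul -!Eur -!Edl -!Edr (det_mx3 B).
by do ![congr (_ + _) | congr (_ * _) | congr (- _)]; congr (B _ _); exact: val_inj.
Qed.
End Poly.

Definition sym2 (R : nzRingType) (x y z : R) : 'M[R]_2 :=
  \matrix_(i, j) if i == j then (if i == 0 then x else z) else y.

Definition col2 (R : nzRingType) (x y : R) : 'cV[R]_2 :=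
  \col_i if i == 0 then x else y.

Lemma char_poly_reflection (R : comNzRingType) (p1 p2 p3 q1 q2 q3 u1 u2 d : R) :
  char_poly (block_mx (sym2 p1 p2 p3) (row_mx (sym2 q1 q2 q3) (col2 u1 u2))
    (col_mx (sym2 q1 q2 q3) (col2 u1 u2)^T)
    (block_mx (sym2 p1 p2 p3) (col2 u1 u2) (col2 u1 u2)^T d%:M)) =
  (('X - (p1 - q1)%:P) * ('X - (p3 - q3)%:P) - (p2 - q2)%:P ^+ 2) *
  (('X - (p1 + q1)%:P) *
     (('X - (p3 + q3)%:P) * ('X - d%:P) - 2 * u2%:P ^+ 2)
   - (p2 + q2)%:P * ((p2 + q2)%:P * ('X - d%:P) + 2 * u1%:P * u2%:P)
   - 2 * u1%:P * ((p2 + q2)%:P * u2%:P + ('X - (p3 + q3)%:P) * u1%:P)).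
Proof.
rewrite /char_poly /char_poly_mx !(map_block_mx, map_row_mx, map_col_mx).
rewrite !(scalar_mx_block, opp_block_mx, add_block_mx, opp_row_mx, opp_col_mx).
rewrite -row_mx0 -col_mx0 add_row_mx add_col_mx !add0r.
rewrite det_reflection det_mx2 det_bordered2 !mxE /= !(polyCD, polyCN); ring.
Qed.

(** * Realizability from a bordered matrix *)

Lemma row_mx_ge0 (R : numDomainType) m n n' (A : 'M[R]_(m, n)) (B : 'M_(m, n')) :
    (forall i j, 0 <= A i j) -> (forall i j, 0 <= B i j) ->
  forall i j, 0 <= row_mx A B i j.
Proof. by move=> A_ge0 B_ge0 i j; rewrite mxE; case: split. Qed.

Lemma col_mx_ge0 (R : numDomainType) m m' n (A : 'M[R]_(m, n)) (B : 'M_(m', n)) :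
    (forall i j, 0 <= A i j) -> (forall i j, 0 <= B i j) ->
  forall i j, 0 <= col_mx A B i j.
Proof. by move=> A_ge0 B_ge0 i j; rewrite mxE; case: split. Qed.

Lemma bordered_expansion (S : comNzRingType) (X m1 m2 m3 d v1 v2 : S) :
  (X - m1) * ((X - m3) * (X - d) - 2 * v2 ^+ 2)
    - m2 * (m2 * (X - d) + 2 * v1 * v2) - 2 * v1 * (m2 * v2 + (X - m3) * v1) =
  X ^+ 3 - (m1 + m3 + d) * X ^+ 2
    + (m1 * m3 - m2 * m2 + (m1 + m3) * d - (2 * v1 * v1 + 2 * v2 * v2)) * X
    - ((m1 * m3 - m2 * m2) * d
       - (m3 * (2 * v1 * v1) + m1 * (2 * v2 * v2) - 2 * m2 * (2 * v1 * v2))).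
Proof. by ring. Qed.

(** The equations compare coefficients: the first two for the characteristic polynomial of N, the
    other three for that of B. *)
Lemma realizable_blocks (R : realType) (l : 5.-tuple R)
    (n1 n2 n3 m1 m2 m3 w1 w2 d x1 x2 x3 y1 y2 : R) :
    `|n1| <= m1 -> `|n2| <= m2 -> `|n3| <= m3 -> 0 <= w1 -> 0 <= w2 -> 0 <= d ->
    n1 + n3 = y1 + y2 -> n1 * n3 - n2 ^+ 2 = y1 * y2 ->
    m1 + m3 + d = x1 + x2 + x3 ->
    m1 * m3 - m2 ^+ 2 + (m1 + m3) * d - (w1 ^+ 2 + w2 ^+ 2) =
      x1 * x2 + x1 * x3 + x2 * x3 ->
    (m1 * m3 - m2 ^+ 2) * d
      - (m3 * w1 ^+ 2 + m1 * w2 ^+ 2 - 2 * m2 * w1 * w2) = x1 * x2 * x3 ->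
    perm_eq l [:: x1; x2; x3; y1; y2] ->
  sym_nonneg_realizable l.
Proof.
rewrite !ler_norml => /andP[n1m m1n] /andP[n2m m2n] /andP[n3m m3n] w1_ge0 w2_ge0
  d_ge0 N1 N2 M1 M2 M3 l_perm.
(* This factor undoes the doubling of the border in [det_reflection]. *)
pose r := (Num.sqrt 2 : R)^-1.
have r_ge0 : 0 <= r by rewrite invr_ge0 sqrtr_ge0.
have r2 : 2 * r ^+ 2 = 1 by rewrite /r exprVn sqr_sqrtr ?ler0n ?mulfV ?pnatr_eq0.
pose P := sym2 ((m1 + n1) / 2) ((m2 + n2) / 2) ((m3 + n3) / 2).
pose Q := sym2 ((m1 - n1) / 2) ((m2 - n2) / 2) ((m3 - n3) / 2).
pose u := col2 (r * w1) (r * w2).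
have P_ge0 i j : 0 <= P i j by rewrite mxE; do 2?case: ifP => _; lra.
have Q_ge0 i j : 0 <= Q i j by rewrite mxE; do 2?case: ifP => _; lra.
have u_ge0 i j : 0 <= u i j by rewrite mxE; case: ifP => _; rewrite mulr_ge0.
have sym2T (a b c : R) : (sym2 a b c)^T = sym2 a b c.
  by apply/matrixP=> i j; rewrite !mxE eq_sym; case: eqP => [->|].
exists (block_mx P (row_mx Q u) (col_mx Q u^T) (block_mx P u u^T d%:M)); split.
- rewrite /sym_mx (tr_block_mx P (row_mx Q u)) tr_row_mx (tr_col_mx Q).
  by rewrite (tr_block_mx P) trmxK tr_scalar_mx !sym2T.
- have uT_ge0 i j : 0 <= u^T i j by rewrite mxE.
  have dM_ge0 i j : 0 <= (d%:M : 'M_1) i j by rewrite mxE mulrn_wge0.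
  move=> i j; rewrite /block_mx.
  by do !(apply: col_mx_ge0 || apply: row_mx_ge0).
rewrite /has_spectrum char_poly_reflection (perm_big _ l_perm) /= !big_cons big_nil /=.
have -> : (m1 + n1) / 2 - (m1 - n1) / 2 = n1 by field.
have -> : (m2 + n2) / 2 - (m2 - n2) / 2 = n2 by field.
have -> : (m3 + n3) / 2 - (m3 - n3) / 2 = n3 by field.
have -> : (m1 + n1) / 2 + (m1 - n1) / 2 = m1 by field.
have -> : (m2 + n2) / 2 + (m2 - n2) / 2 = m2 by field.
have -> : (m3 + n3) / 2 + (m3 - n3) / 2 = m3 by field.
have -> : ('X - n1%:P) * ('X - n3%:P) - n2%:P ^+ 2 = ('X - y1%:P) * ('X - y2%:P).
  transitivity ('X^2 - (n1 + n3)%:P * 'X + (n1 * n3 - n2 ^+ 2)%:P : {poly R}).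
    by ring.
  by rewrite N1 N2; ring.
have rr a b : 2 * (r * a) * (r * b) = a * b.
  by transitivity (2 * r ^+ 2 * (a * b)); [ring | rewrite r2 mul1r].
move: M2 M3; rewrite -[2 * m2 * w1 * w2]mulrA !expr2 -(rr w1 w1) -(rr w2 w2) -(rr w1 w2).
move: (r * w1) (r * w2) => v1 v2 M2 M3.
transitivity (('X - y1%:P) * ('X - y2%:P) *
  (('X - x1%:P) * ('X - x2%:P) * ('X - x3%:P)) : {poly R}); last first.
  by rewrite mulr1 mulrC !mulrA.
congr (_ * _); rewrite bordered_expansion.
have eqC := congr1 (@polyC R); move: (eqC _ _ M1) (eqC _ _ M2) (eqC _ _ M3).
rewrite !(polyCD, polyCN, polyCM, polyC_natr) => -> -> ->.
by ring.
Qed.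

(** The second form is that of the adjugate of M = [[m1, m2], [m2, m3]]. In the first quadrant its
    quotient by w^T w goes from [m3] at (1, 0) down to the least eigenvalue, whose eigenvector is
    positive because [0 < m2]; the discriminant condition puts K2 / K1 between the eigenvalues. *)
Lemma border_vector (R : realType) (m1 m2 m3 K1 K2 : R) :
  0 < m2 -> 0 <= K1 -> K2 <= m3 * K1 ->
  0 <= (K2 - m1 * K1) * (m3 * K1 - K2) + m2 ^+ 2 * K1 ^+ 2 ->
  exists w : R * R, [/\ 0 <= w.1, 0 <= w.2, w.1 ^+ 2 + w.2 ^+ 2 = K1
    & m3 * w.1 ^+ 2 + m1 * w.2 ^+ 2 - 2 * m2 * w.1 * w.2 = K2].
Proof.
move=> m2_gt0; rewrite le_eqVlt => /predU1P[<- _ disc|K1_gt0 leK2 disc].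
  have K2_0 : K2 = 0.
    apply/eqP; rewrite -sqrf_eq0 eq_le sqr_ge0 andbT; move: disc; lra.
  by exists (0, 0); split; rewrite //= ?K2_0; ring.
set D := _ + _ in disc.
(* [tau] is the slope w_2 / w_1, a root of
   (K2 - m1 K1) tau^2 + 2 m2 K1 tau = m3 K1 - K2; this form of the root needs no
   case analysis on the sign of K2 - m1 K1. *)
have den_gt0 : 0 < m2 * K1 + Num.sqrt D.
  by rewrite ltr_wpDr ?sqrtr_ge0 ?mulr_gt0.
pose tau := (m3 * K1 - K2) / (m2 * K1 + Num.sqrt D).
have tau_ge0 : 0 <= tau by rewrite divr_ge0 ?subr_ge0 ?(ltW den_gt0).
have tau_root : (K2 - m1 * K1) * tau ^+ 2 + 2 * m2 * K1 * tau = m3 * K1 - K2.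
  have DE := sqr_sqrtr disc; move: den_gt0 DE; rewrite /tau.
  move: (Num.sqrt _) => r /gt_eqF/negbT r0 DE.
  have key : (K2 - m1 * K1) * (m3 * K1 - K2) = r ^+ 2 - m2 ^+ 2 * K1 ^+ 2.
    by rewrite DE /D; ring.
  rewrite [LHS](_ : _ = (m3 * K1 - K2) / (m2 * K1 + r) *
    ((K2 - m1 * K1) * (m3 * K1 - K2) / (m2 * K1 + r) + 2 * m2 * K1)); last by field.
  by rewrite key; field.
have nrm_gt0 : 0 < 1 + tau ^+ 2 by rewrite ltr_pwDl ?sqr_ge0.
have sq : Num.sqrt (K1 / (1 + tau ^+ 2)) ^+ 2 = K1 / (1 + tau ^+ 2).
  by rewrite sqr_sqrtr ?divr_ge0 ?ltW.
exists (Num.sqrt (K1 / (1 + tau ^+ 2)), tau * Num.sqrt (K1 / (1 + tau ^+ 2))).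
move: (Num.sqrt _) (sqrtr_ge0 (K1 / (1 + tau ^+ 2))) sq => w w_ge0 sq.
have nz := lt0r_neq0 nrm_gt0.
split => //=; first exact: mulr_ge0.
  by rewrite exprMn sq; field.
rewrite (_ : _ - _ = w ^+ 2 * (m3 + m1 * tau ^+ 2 - 2 * m2 * tau)); last ring.
rewrite sq mulrAC; apply: (canLR (mulfK nz)).
by move: tau_root; lra.
Qed.

(** [K1] and [K2] are the values of w^T w and w^T adj(M) w forced by the second and third elementary
    symmetric functions of [x1], [x2], [x3]. *)
Lemma realizable_bordered (R : realType) (l : 5.-tuple R)
    (n1 n2 n3 m1 m2 m3 d x1 x2 x3 y1 y2 K1 K2 : R) :
    `|n1| <= m1 -> `|n2| <= m2 -> `|n3| <= m3 -> 0 < m2 -> 0 <= d ->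
    n1 + n3 = y1 + y2 -> n1 * n3 - n2 ^+ 2 = y1 * y2 ->
    m1 + m3 + d = x1 + x2 + x3 ->
    K1 = m1 * m3 - m2 ^+ 2 + (m1 + m3) * d - (x1 * x2 + x1 * x3 + x2 * x3) ->
    K2 = (m1 * m3 - m2 ^+ 2) * d - x1 * x2 * x3 ->
    0 <= K1 -> K2 <= m3 * K1 ->
    ((x1 - m1) * (x1 - m3) - m2 ^+ 2) * ((x2 - m1) * (x2 - m3) - m2 ^+ 2)
      * ((x3 - m1) * (x3 - m3) - m2 ^+ 2) <= 0 ->
    perm_eq l [:: x1; x2; x3; y1; y2] ->
  sym_nonneg_realizable l.
Proof.
move=> n1m n2m n3m m2_gt0 d_ge0 N1 N2 M1 K1E K2E K1_ge0 leK2 chi_le0 l_perm.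
have dE : d = x1 + x2 + x3 - m1 - m3 by rewrite -M1; ring.
(* The discriminant is minus the product of the values of chi_M at x1, x2, x3:
   up to sign, both are the resultant of the characteristic polynomials of M
   and of the bordered matrix. *)
have disc_ge0 : 0 <= (K2 - m1 * K1) * (m3 * K1 - K2) + m2 ^+ 2 * K1 ^+ 2.
  by rewrite -oppr_le0; apply: le_trans chi_le0; rewrite K1E K2E dE le_eqVlt;
    apply/orP; left; apply/eqP; ring.
have [[w1 w2] /= [w1_ge0 w2_ge0 W1 W2]] := border_vector m2_gt0 K1_ge0 leK2 disc_ge0.
apply: (realizable_blocks n1m n2m n3m w1_ge0 w2_ge0 d_ge0 N1 N2 M1 _ _ l_perm).
  by rewrite W1 K1E; ring.
by rewrite W2 K2E; ring.
Qed.

(** * The two explicit choices of N and M *)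

(* Q_sigma(z) for sigma = (x1, x2, y1, x3, y2). *)
Definition Qval (R : comNzRingType) (x1 x2 x3 y1 y2 z : R) : R :=
  2 * z ^+ 3 - 2 * (y1 + y2) * z ^+ 2
  - (x1 * x2 + x1 * x3 + x2 * x3 + (x1 + x2 + x3) * (y1 + y2) + y1 * y2
     + (y1 - y2) ^+ 2) * z
  + (x1 * x2 * x3 + (x1 * x2 + x1 * x3 + x2 * x3) * (y1 + y2)
     + (x1 + x2 + x3) * (y1 * y2))
  + (x1 + x2 + x3 + y1 + y2) * (y1 ^+ 2 + y2 ^+ 2).

(** Here M = |N| and [chi] is the characteristic polynomial of M. The difference [m3 * K1 - K2] is
    exactly [Qval], which is where Q_sigma comes from. *)
Lemma realizable_cycle (R : realType) (l : 5.-tuple R) (x1 x2 x3 y1 y2 g : R) :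
    let chi x := (x - g) * (x - (g - y1 - y2)) - (y1 - g) * (g - y2) in
    let d := x1 + x2 + x3 + y1 + y2 - 2 * g in
    0 <= g -> g < y1 -> y2 < g -> y1 + y2 <= g ->
    0 <= d -> x3 <= d -> d <= x2 ->
    0 <= chi x1 -> chi x2 <= 0 -> 0 <= chi x3 -> 0 <= Qval x1 x2 x3 y1 y2 g ->
    perm_eq l [:: x1; x2; x3; y1; y2] ->
  sym_nonneg_realizable l.
Proof.
move=> chi d g_ge0 g_lt1 g_gt2 C_ge0 d_ge0 x3d dx2 chi1 chi2 chi3 Q_ge0.
have b2_gt0 : 0 < (y1 - g) * (g - y2) by rewrite mulr_gt0 ?subr_gt0.
have bE := sqr_sqrtr (ltW b2_gt0).
apply: (@realizable_bordered _ _ g (Num.sqrt ((y1 - g) * (g - y2))) (y1 + y2 - g)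
  g (Num.sqrt ((y1 - g) * (g - y2))) (g - y1 - y2) d _ _ _ _ _ _ _
  _ _ _ _ _ _ _ _ erefl erefl); rewrite ?bE.
- by rewrite ger0_norm.
- by rewrite ger0_norm ?sqrtr_ge0.
- by rewrite ler0_norm; lra.
- by rewrite sqrtr_gt0.
- by [].
- by ring.
- by ring.
- by rewrite /d; ring.
- have -> : g * (g - y1 - y2) - (y1 - g) * (g - y2) + (g + (g - y1 - y2)) * d
    - (x1 * x2 + x1 * x3 + x2 * x3) = chi x1 + (d - x3) * (x2 - d).
    by rewrite /chi /d; ring.
  by apply: addr_ge0 => //; apply: mulr_ge0; rewrite subr_ge0.
- rewrite -subr_ge0; apply: le_trans Q_ge0 _; rewrite le_eqVlt.
  by apply/orP; left; apply/eqP; rewrite /d /Qval; ring.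
- rewrite -/(chi x1) -/(chi x2) -/(chi x3).
  by apply: mulr_le0_ge0 => //; apply: mulr_ge0_le0.
Qed.

(** The sum [t] of the list separates [x2] from [x1], so [K1 = (x1 - t) * (t - x2)] is nonnegative,
    and [m3 * K1 - K2] is [d - c + f] times it. *)
Lemma realizable_small (R : realType) (l : 5.-tuple R) (x1 x2 c d f t : R) :
    0 < c -> c <= d -> d <= f -> 0 <= t -> t <= x1 -> x2 <= t ->
    x1 + x2 + c = t + d + f ->
    perm_eq l [:: x1; x2; c; - d; - f] ->
  sym_nonneg_realizable l.
Proof.
move=> c_gt0 cd df t_ge0 tx1 x2t tE l_perm.
have d_gt0 : 0 < d by apply: lt_le_trans cd.
have f_gt0 : 0 < f by apply: lt_le_trans df.
have m2_gt0 : 0 < f * (d - c + f) by rewrite mulr_gt0 //; lra.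
have mE := sqr_sqrtr (ltW m2_gt0).
have nE := sqr_sqrtr (mulr_ge0 (ltW c_gt0) (ltW d_gt0)).
have x2E : x2 = t + d + f - c - x1 by lra.
(* M = [[0, m2], [m2, d - c]] with m2^2 = f (d - c + f) has the eigenvalue - f. *)
apply: (@realizable_bordered _ _ 0 (Num.sqrt (c * d)) (c - d)
  0 (Num.sqrt (f * (d - c + f))) (d - c) t x1 x2 (- f) c (- d) _ _
  _ _ _ _ _ _ _ _ erefl erefl); rewrite ?mE ?nE.
- by rewrite normr0.
(* The radicands differ by [(d + f) * (f - c)]. *)
- by rewrite ger0_norm ?sqrtr_ge0 // ler_wsqrtr //; nra.
- by rewrite ler0_norm; lra.
- by rewrite sqrtr_gt0.
- by [].
- by ring.
- by ring.
- by lra.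
- have -> : 0 * (d - c) - f * (d - c + f) + (0 + (d - c)) * t
    - (x1 * x2 + x1 * - f + x2 * - f) = (x1 - t) * (t - x2).
    by rewrite x2E; ring.
  by rewrite mulr_ge0 ?subr_ge0.
- rewrite -subr_ge0 [leRHS](_ : _ = (d - c + f) * ((x1 - t) * (t - x2))).
    by rewrite !mulr_ge0 ?subr_ge0 //; lra.
  by rewrite x2E; ring.
- rewrite [leLHS](_ : _ = 0) //; by ring.
- apply: (perm_trans l_perm); rewrite !perm_cons.
  exact: (permEl (perm_catC [:: c; - d] [:: - f])).
Qed.

(** * Inequalities satisfied at a root of Q_sigma *)

(** The list is [(a, b, c, - d, - f)], with sum [t]. The first two bounds serve to control the
    increments of [Qval]; the third is [0 <= chi a] for the [chi] of [realizable_cycle]. *)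
Lemma Qval_root_bounds (R : realType) (a b c d f g t : R) :
    b <= a -> c <= b -> d <= f -> f <= a -> t = a + b + c - d - f ->
    0 <= t -> t < c -> 0 <= g -> 2 * g <= t -> Qval a b (- d) c (- f) g = 0 ->
  [/\ b + c < f + g, 2 * g * (c - g) <= (a - f) * (d + f)
    & (c - g) * (g + f) <= (a - g) * (a - f + c - g)].
Proof.
move=> ba cb df fa tE t_ge0 tc g_ge0 gt Q0.
have dE : d = a + b + c - f - t by lra.
set u := f + g - (b + c); set k := a - f.
pose Y := (c - g) * (b + c) * (b + 2 * g - t).
(* Q(g) = u (k (d + f) - 2 g (c - g)) - Y; since Y > 0, both factors are
   nonzero of the same sign, and the bounds on g and t force u > 0. *)
have factorQ : u * (k * (d + f) - 2 * g * (c - g)) = Y.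
  apply/eqP; rewrite -subr_eq0 -[X in _ == X]Q0 /u /k /Y dE /Qval; apply/eqP.
  by ring.
have cg : 0 < c - g by lra.
have bt : 0 < b + 2 * g - t by lra.
have bc : 0 < b + c by lra.
have Y_gt0 : 0 < Y by rewrite /Y !mulr_gt0.
have k_ge0 : 0 <= k by rewrite /k; lra.
have u_ge : k + g - t <= u by rewrite /u /k; lra.
have df_gt0 : 0 < d + f by lra.
have u_gt0 : 0 < u.
  (* If [u <= 0], then [u_ge] bounds [Y] by [(t - g) * (2 * g) * (c - g)], which is too small. *)
  rewrite ltNge; apply/negP => u_le0.
  suff : Y < Y by rewrite ltxx.
  rewrite -{1}factorQ.
  have h1 : u * (k * (d + f)) <= 0 by rewrite mulr_le0_ge0 // mulr_ge0 // ltW.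
  have h2 : - u * (2 * g * (c - g)) <= (t - g) * (2 * g * (c - g)).
    by apply: ler_wpM2r; [rewrite !mulr_ge0 ?(ltW cg) | lra].
  have h3 : (t - g) * (2 * g) < (b + c) * (b + 2 * g - t) by nra.
  have h4 : (t - g) * (2 * g) * (c - g) < Y by rewrite /Y; nra.
  by lra.
have k_lb : 2 * g * (c - g) <= k * (d + f).
  by rewrite -subr_ge0 -(pmulr_rge0 _ u_gt0) factorQ ltW.
split=> //; first by move: u_gt0; rewrite /u; lra.
(* After multiplication by [d + f = (b + 2 * g - t) + (a + c - 2 * g)], the first summand accounts
   for [Y] and the second for the remaining term. *)
have uk_le : u * k <= (c - g) * (b + c).
  rewrite -(ler_pM2r df_gt0).
  have -> : u * k * (d + f) = Y + u * (2 * g * (c - g)) by rewrite -factorQ; ring.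
  have h : 2 * g * u <= (b + c) * (a + c - 2 * g).
    by apply: ler_pM; rewrite ?(ltW u_gt0) //; rewrite ?/u; lra.
  rewrite (_ : d + f = b + 2 * g - t + (a + c - 2 * g)); last by rewrite dE; ring.
  rewrite /Y; nra.
(* Once [u] is cancelled, this rearranges to the third bound. *)
have h : u * (k * (a + c - 2 * g)) >= u * (2 * g * (c - g)).
  have -> : k * (a + c - 2 * g) = k * (d + f) - k * (b + 2 * g - t).
    by rewrite dE; ring.
  have : u * (k * (d + f)) = Y + u * (2 * g * (c - g)) by rewrite -factorQ; ring.
  by rewrite /Y mulrBr mulrA; nra.
move: h; rewrite ler_pM2l // /k; lra.
Qed.

(** * The four perturbations *)

(** The linear hypotheses settle the signs of [chi] at [y] and [- d]; only those of [chi x] and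
    [Qval] are left to each perturbation. *)
Lemma realizable_cycle_large (R : realType) (l : 5.-tuple R) (x y c d f g t : R) :
    t = x + y + c - d - f -> 0 <= g -> 2 * g <= t -> t < c -> t <= y -> c <= d ->
    y + c - t <= f ->
    (c - g) * (g + f) <= (x - g) * (x + c - f - g) ->
    0 <= Qval x y (- d) c (- f) g ->
    perm_eq l [:: x; y; c; - d; - f] ->
  sym_nonneg_realizable l.
Proof.
move=> tE g_ge0 gt tc ty cd ycf chi1 Q_ge0 l_perm.
apply: (@realizable_cycle _ _ x y (- d) c (- f) g); rewrite ?opprK //; try lra.
- have h : (y - g) * (y + c - f - g) <= (y - g) * (t - g) by apply: ler_wpM2l; lra.
  have h' : (t - g) * (y - g) <= (c - g) * (g + f) by apply: ler_pM; lra.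
  by lra.
- have h : (c - g) * (g + f) <= (d + g) * (d + g - c + f) by apply: ler_pM; lra.
  by lra.
- apply: (perm_trans l_perm); rewrite !perm_cons.
  exact: (permEl (perm_catCA [:: c] [:: - d] _)).
Qed.

Lemma realizable_perturb2 (R : realType) (l : 5.-tuple R) (a b c d f g t s : R) :
    b <= a -> c <= b -> d <= f -> f <= a -> t = a + b + c - d - f ->
    0 <= t -> t < c -> 0 <= g -> 2 * g <= t -> Qval a b (- d) c (- f) g = 0 ->
    0 < s ->
    perm_eq l [:: a + s; b - s; c; - d; - f] ->
  sym_nonneg_realizable l.
Proof.
move=> ba cb df fa tE t_ge0 tc g_ge0 gt Q0 s_gt0 l_perm.
have [bcf _ chi_a] := Qval_root_bounds ba cb df fa tE t_ge0 tc g_ge0 gt Q0.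
have [st|ts] := lerP (b - s) t.
  apply: (@realizable_small R l (a + s) (b - s) c d f t) => //; lra.
apply: (@realizable_cycle_large _ _ (a + s) (b - s) c d f g t) => //; try lra.
- have h : (a - g) * (a - f + c - g) <= (a + s - g) * (a + s + c - f - g).
    by apply: ler_pM; lra.
  by lra.
- have -> : Qval (a + s) (b - s) (- d) c (- f) g =
    Qval a b (- d) c (- f) g + s * (a - b + s) * (g - c + f + d).
    by rewrite /Qval; ring.
  by rewrite Q0 add0r !mulr_ge0 //; lra.
Qed.

Lemma realizable_perturb3 (R : realType) (l : 5.-tuple R) (a b c d f g t s : R) :
    b <= a -> c <= b -> d <= f -> f <= a -> t = a + b + c - d - f ->
    0 <= t -> t < c -> 0 <= g -> 2 * g <= t -> Qval a b (- d) c (- f) g = 0 ->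
    0 < s ->
    perm_eq l [:: a + s; b; c - s; - d; - f] ->
  sym_nonneg_realizable l.
Proof.
move=> ba cb df fa tE t_ge0 tc g_ge0 gt Q0 s_gt0 l_perm.
have [bcf _ chi_a] := Qval_root_bounds ba cb df fa tE t_ge0 tc g_ge0 gt Q0.
have [st|ts] := lerP (c - s) t.
  (* Now [t] separates [c - s] from [a + s], and [b] becomes an eigenvalue of N; [b <= d] follows
     from [t < c] and [f <= a]. *)
  have l_perm' : perm_eq l [:: a + s; c - s; b; - d; - f].
    apply: (perm_trans l_perm); rewrite perm_cons.
    exact: (permEl (perm_catCA [:: b] [:: c - s] _)).
  by apply: (@realizable_small _ _ (a + s) (c - s) b d f t) => //; lra.
apply: (@realizable_cycle_large _ _ (a + s) b (c - s) d f g t) => //; try lra.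
- have h : (a - g) * (a - f + c - g) <= (a + s - g) * (a + s + (c - s) - f - g).
    by apply: ler_pM; lra.
  have h' : (c - s - g) * (g + f) <= (c - g) * (g + f) by apply: ler_wpM2r; lra.
  by lra.
- have -> : Qval (a + s) b (- d) (c - s) (- f) g = Qval a b (- d) c (- f) g +
    s * (2 * g * (g + f) + (a + c) * (g - t + a - c + s)).
    by rewrite /Qval tE; ring.
  rewrite Q0 add0r; apply: mulr_ge0; first exact: ltW.
  by apply: addr_ge0; apply: mulr_ge0; lra.
Qed.

Lemma realizable_perturb4 (R : realType) (l : 5.-tuple R) (a b c d f g t s : R) :
    b <= a -> c <= b -> d <= f -> f <= a -> t = a + b + c - d - f ->
    0 <= t -> t < c -> 0 <= g -> 2 * g <= t -> Qval a b (- d) c (- f) g = 0 ->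
    0 < s ->
    perm_eq l [:: a + s; b; c; - (d + s); - f] ->
  sym_nonneg_realizable l.
Proof.
move=> ba cb df fa tE t_ge0 tc g_ge0 gt Q0 s_gt0 l_perm.
have [bcf _ chi_a] := Qval_root_bounds ba cb df fa tE t_ge0 tc g_ge0 gt Q0.
apply: (@realizable_cycle_large _ _ (a + s) b c (d + s) f g t) => //; try lra.
- have h : (a - g) * (a - f + c - g) <= (a + s - g) * (a + s + c - f - g).
    by apply: ler_pM; lra.
  by lra.
- have -> : Qval (a + s) b (- (d + s)) c (- f) g = Qval a b (- d) c (- f) g +
    s * (a + d + s) * (f + g - b - c).
    by rewrite /Qval; ring.
  by rewrite Q0 add0r !mulr_ge0 //; lra.
Qed.

Lemma realizable_perturb5 (R : realType) (l : 5.-tuple R) (a b c d f g t s : R) :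
    b <= a -> c <= b -> d <= f -> f <= a -> t = a + b + c - d - f ->
    0 <= t -> t < c -> 0 <= g -> 2 * g <= t -> Qval a b (- d) c (- f) g = 0 ->
    0 < s ->
    perm_eq l [:: a + s; b; c; - d; - (f + s)] ->
  sym_nonneg_realizable l.
Proof.
move=> ba cb df fa tE t_ge0 tc g_ge0 gt Q0 s_gt0 l_perm.
have [bcf k_lb chi_a] := Qval_root_bounds ba cb df fa tE t_ge0 tc g_ge0 gt Q0.
apply: (@realizable_cycle_large _ _ (a + s) b c d (f + s) g t) => //; try lra.
- have h : (c - g) * s <= (a - f + c - g) * s by apply: ler_wpM2r; lra.
  by lra.
- have -> : Qval (a + s) b (- d) c (- (f + s)) g = Qval a b (- d) c (- f) g +
    s * (2 * g * (g - c) + (a - f) * (g - t + a + f + s)).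
    by rewrite /Qval tE; ring.
  rewrite Q0 add0r; apply: mulr_ge0; first exact: ltW.
  (* The factors [d + f] and [g - t + a + f + s] compare by [bcf]; then [k_lb] absorbs the negative
     term. *)
  have h : (a - f) * (d + f) <= (a - f) * (g - t + a + f + s).
    by apply: ler_wpM2l; lra.
  by lra.
Qed.

(** * Symmetric functions and perturbed lists in coordinates *)

(** Expanding the product, the set [J] of factors that contribute their linear term yields a
    monomial of degree [#|J|]. *)
Lemma esf_coef (R : realType) (s : 5.-tuple R) n :
  esf s n = (\prod_(j < 5) ((tnth s j)%:P * 'X + 1))`_n.
Proof.
rewrite bigA_distr coef_sum /esf big_mkcond /=; apply: eq_bigr => J _.
rewrite -big_mkcond /= big_split /= prodr_const -rmorph_prod /= coefCM coefXn eq_sym.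
by case: eqP; rewrite ?mulr1 ?mulr0.
Qed.

Lemma esfE (R : realType) (l1 l2 l3 l4 l5 : R) :
  let s := [tuple l1; l2; l3; l4; l5] in
  [/\ esf s 1 = l1 + l2 + l3 + l4 + l5,
      esf s 2 = l1 * l2 + l1 * l3 + l1 * l4 + l1 * l5 + l2 * l3 + l2 * l4
        + l2 * l5 + l3 * l4 + l3 * l5 + l4 * l5
    & esf s 3 = l1 * l2 * l3 + l1 * l2 * l4 + l1 * l2 * l5 + l1 * l3 * l4
        + l1 * l3 * l5 + l1 * l4 * l5 + l2 * l3 * l4 + l2 * l3 * l5
        + l2 * l4 * l5 + l3 * l4 * l5].
Proof.
rewrite /= !esf_coef !big_ord_recl !big_ord0 !(tnth_nth 0) /= mulr1.
set p : {poly R} := _ * _.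
(* All six coefficients are listed, so that [p = q] is a ring identity. *)
pose q := \poly_(i < 6) [:: 1; l1 + l2 + l3 + l4 + l5;
  l1 * l2 + l1 * l3 + l1 * l4 + l1 * l5 + l2 * l3 + l2 * l4
        + l2 * l5 + l3 * l4 + l3 * l5 + l4 * l5;
  l1 * l2 * l3 + l1 * l2 * l4 + l1 * l2 * l5 + l1 * l3 * l4
        + l1 * l3 * l5 + l1 * l4 * l5 + l2 * l3 * l4 + l2 * l3 * l5
        + l2 * l4 * l5 + l3 * l4 * l5;
  l1 * l2 * l3 * l4 + l1 * l2 * l3 * l5 + l1 * l2 * l4 * l5
        + l1 * l3 * l4 * l5 + l2 * l3 * l4 * l5;
  l1 * l2 * l3 * l4 * l5]`_i.
suff -> : p = q by split; rewrite coef_poly.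
rewrite /q poly_def !big_ord_recl big_ord0 /= /p -!mul_polyC.
by ring.
Qed.

Lemma perturbE (R : realType) (l1 l2 l3 l4 l5 s : R) i :
  perturb [tuple l1; l2; l3; l4; l5] i s = [:: l1 + s;
    if i == 2 then l2 - s else l2;
    if i == 3 then l3 - s else l3;
    if i == 4 then l4 - s else l4;
    if i == 5 then l5 - s else l5] :> seq R.
Proof.
apply: (@eq_from_nth _ 0) => [|k k_lt]; first by rewrite (size_tuple (perturb _ _ _)).
have k_lt5 : (k < 5)%N by rewrite (size_tuple (perturb _ _ _)) in k_lt.
rewrite -(tnth_nth 0 _ (Ordinal k_lt5)) tnth_mktuple !(tnth_nth 0) /=.
by case: k {k_lt} k_lt5 => [|[|[|[|[|k]]]]] //= _; rewrite eq_sym.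
Qed.

Theorem theorem9 (R : realType) (sigma : 5.-tuple R) (g : R)
    (h_i : 0 <= esf sigma 1)
    (h_ii : esf sigma 1 < lam sigma 3)
    (h_iii : [/\ lam sigma 2 <= lam sigma 1, lam sigma 3 <= lam sigma 2,
                 lam sigma 4 <= lam sigma 3, lam sigma 5 <= lam sigma 4
               & - lam sigma 1 <= lam sigma 5])
    (h_iv : root (Qpoly sigma) g /\ 0 <= g <= 2^-1 * esf sigma 1)
    (h_v : rfun sigma < 0) :
  forall (s : R) (i : nat), 0 < s -> (2 <= i <= 5)%N ->
    sym_nonneg_realizable (perturb sigma i s).
Proof.
case: sigma h_i h_ii h_iii h_iv {h_v} => -[|a [|b [|c [|p [|q [|? ?]]]]]] // sz.
have -> : Tuple sz = [tuple a; b; c; p; q] by exact: val_inj.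
have [E1 E2 E3] := esfE a b c p q; rewrite /Qpoly E1 E2 E3 {E1 E2 E3} /lam /=.
move=> t_ge0 tc [ba cb pc qp aq] [/rootP + /andP[g_ge0 gt]] s i s_gt0 i_range.
rewrite !(hornerD, hornerN, hornerZ, hornerXn, hornerX, hornerC) => Q0.
(* The lemmas are applied with [d := - p] and [f := - q], hence the double signs. *)
have Q0' : Qval a b (- - p) c (- - q) g = 0.
  by rewrite -[RHS]Q0 /Qval; ring.
have df : - p <= - q by rewrite lerN2.
have fa : - q <= a by rewrite lerNl.
have tE : a + b + c + p + q = a + b + c - - p - - q by ring.
have gt' : 2 * g <= a + b + c + p + q by lra.
have pE := perturbE a b c p q s i.
case: i i_range pE => [|[|[|[|[|[|i]]]]]] // _ pE.
- apply: (realizable_perturb2 ba cb df fa tE t_ge0 tc g_ge0 gt' Q0' s_gt0).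
  by rewrite pE /= !opprK.
- apply: (realizable_perturb3 ba cb df fa tE t_ge0 tc g_ge0 gt' Q0' s_gt0).
  by rewrite pE /= !opprK.
- apply: (realizable_perturb4 ba cb df fa tE t_ge0 tc g_ge0 gt' Q0' s_gt0).
  by rewrite pE /= opprD !opprK.
- apply: (realizable_perturb5 ba cb df fa tE t_ge0 tc g_ge0 gt' Q0' s_gt0).
  by rewrite pE /= opprD !opprK.
Qed.
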